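(* Let $I\subseteq\mathbb{R}$ be a finite or infinite interval, $w$ a weight function on $I$, and $\{P_n\}_{n\ge 0}$ the normalized orthogonal polynomials in $L^2_w(I)$. Consider coefficient functions $\bar A_{\tau,\sigma}$, $B_\tau$, $C_\tau$ ($\tau,\sigma\in I$) with $C_\tau=\tau$, and suppose that $\tau\mapsto B_\tau$, $\sigma\mapsto \bar A_{\tau,\sigma}$ (for each $\tau$) and $\tau\mapsto B_\tau\bar A_{\tau,\sigma}$ (for each $\sigma$) belong to $L^2_w(I)$. Let $\mathcal{B}(\xi)$, $\mathcal{CN}(\eta)$, $\mathcal{DN}(\zeta)$ be the simplifying assumptions defined in the context ($\xi,\eta,\zeta$ positive integers). Then: (a) $\mathcal{B}(\xi)$ holds if and only if $B_\tau$ has the form $$B_\tau=\sum_{j=0}^{\xi-1}\Big(\int_0^1P_j(x)\,dx\Big) P_j(\tau)+\sum_{j\ge\xi}\lambda_jP_j(\tau),$$ where the $\lambda_j$ are any real parameters; (b) $\mathcal{CN}(\eta)$ holds if and only if $\bar A_{\tau,\sigma}$ has the form $$\bar A_{\tau,\sigma}=\sum_{j=0}^{\eta-2}\Big(\int_0^\tau\int_0^\alpha P_j(x)\,dx\,d\alpha\Big) P_j(\sigma)+\sum_{j\ge\eta-1}\phi_j(\tau)P_j(\sigma),$$ where the $\phi_j(\tau)$ are any $L^2_w$-integrable real functions; (c) $\mathcal{DN}(\zeta)$ holds if and only if $B_\tau\bar A_{\tau,\sigma}$ has the form $$B_\tau\bar A_{\tau,\sigma}=\sum_{j=0}^{\zeta-2}B_\sigma\Big(\int_0^\sigma\int_1^\alpha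 P_j(x)\,dx\,d\alpha+\int_0^1xP_j(x)\,dx\Big)P_j(\tau)+\sum_{j\ge\zeta-1}\psi_j(\sigma)P_j(\tau),$$ where the $\psi_j(\sigma)$ are any $L^2_w$-integrable real functions.
   Context: A non-negative function $w$ on $I$ is a weight function if (a) all moments $\int_I x^kw(x)\,dx$, $k\in\mathbb{N}$, exist, and (b) for any non-negative function $u$, $\int_I u(x)w(x)\,dx=0$ implies $u\equiv 0$. $L^2_w(I)$ is the Hilbert space of measurable $u$ with $\int_I|u|^2w\,dx<\infty$, with inner product $\langle u,v\rangle_w=\int_I u(x)v(x)w(x)\,dx$. $\{P_n\}_{n\ge0}$ denotes the sequence of orthogonal polynomials ($\deg P_n=n$) for $w$ on $I$, normalized by $\langle P_i,P_j\rangle_w=\delta_{ij}$; it is assumed to be a complete set in $L^2_w(I)$. Infinite series are orthogonal expansions in $L^2_w(I)$ with respect to the argument of the $P_j$; an empty sum is zero. Simplifying assumptions (for all $\tau,\sigma\in I$, integer $\kappa$): $$\mathcal{B}(\xi):\ \int_IB_\tau w(\tau)C_\tau^{\kappa-1}\,d\tau=\frac1\kappa,\quad 1\le\kappa\le\xi;$$ $$\mathcal{CN}(\eta):\ \int_I\bar A_{\tau,\sigma}w(\sigma)C_\sigma^{\kappa-1}\,d\sigma=\frac{C_\tau^{\kappa+1}}{\kappa(\kappa+1)},\quad 1\le\kappa\le\eta-1;$$ $$\mathcal{DN}(\zeta):\ \int_IB_\tau w(\tau)C_\tau^{\kappa-1}\bar A_{\tau,\sigma}\,d\tau=\frac{B_\sigma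 C_\sigma^{\kappa+1}}{\kappa(\kappa+1)}-\frac{B_\sigma C_\sigma}{\kappa}+\frac{B_\sigma}{\kappa+1},\quad 1\le\kappa\le\zeta-1.$$
   Formalization: In (b), (c) the ''only if'' with L²_w φ_j, ψ_j fails in general (I=(0,1], w=1, φ_{η-1}=1/τ). Proved: the iff with arbitrary real φ_j, ψ_j, and the iff with φ_j, ψ_j in L²_w assuming the Fourier coefficients of Ā_{τ,·} and B·Ā_{·,σ} (j≥η-1, ζ-1) are in L²_w. *)

(* Defs.v *)
From HB Require Import structures.
From mathcomp Require Import all_boot all_order all_algebra.
From mathcomp Require Import all_classical all_reals all_analysis.

Set Implicit Arguments.
Unset Strict Implicit.
Unset Printing Implicit Defensive.

Import Order.TTheory GRing.Theory Num.Theory.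
Import numFieldNormedType.Exports.

Local Open Scope classical_set_scope.
Local Open Scope ring_scope.

(* All functions are total on R; only their values on I are ever used. *)

Section WeightedL2.
Context {R : realType}.
Local Notation mu := (@lebesgue_measure R).
Implicit Types (I : interval R) (w u v : R -> R).

(* In [weight_definite], "u = 0" can only mean Lebesgue-a.e. on I: the
   integral does not see null sets, so no w would satisfy the condition with
   pointwise vanishing.  Measurability of w follows from k = 0 in
   [weight_moment]. *)
Record is_weight I w : Prop := IsWeight {
  weight_ge0 : forall x, x \in I -> 0 <= w x ;
  weight_moment : forall k : nat,
    mu.-integrable [set` I] (fun x => (x ^+ k * w x)%:E) ;
  weight_definite : forall u,
    measurable_fun [set` I] u ->
    (forall x, x \in I -> 0 <= u x) ->
    (\int[mu]_(x in [set` I]) (u x * w x)%:E = 0)%E ->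
    {ae mu, forall x, x \in I -> u x = 0} }.

Definition sqnorm I w u : \bar R :=
  (\int[mu]_(x in [set` I]) (`|u x| ^+ 2 * w x)%:E)%E.

Definition L2w I w u : Prop :=
  measurable_fun [set` I] u /\ (sqnorm I w u < +oo)%E.

Definition ip I w u v : R :=
  \int[mu]_(x in [set` I]) (u x * v x * w x).

(* deg (P n) = n; the sign of each P n is left free. *)
Definition orthonormal_polys I w (P : nat -> {poly R}) : Prop :=
  (forall n, size (P n) = n.+1) /\
  (forall i j, ip I w (horner (P i)) (horner (P j)) = (i == j)%:R).

(* The linear span of the P j is dense in L^2_w(I). *)
Definition complete_set I w (P : nat -> {poly R}) : Prop :=
  forall u, L2w I w u -> forall e : R, 0 < e ->
  exists (n : nat) (c : nat -> R),
    (sqnorm I w (fun x => u x - \sum_(0 <= j < n) c j * (P j).[x])%R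
      < e%:E)%E.

(* u = \sum_(j < m) a j * P j + \sum_(j >= m) l j * P j, the infinite series
   converging to its sum in the norm of L^2_w(I). *)
Definition L2w_expansion I w (P : nat -> {poly R}) (m : nat) u
    (a l : nat -> R) : Prop :=
  sqnorm I w (fun x => u x - (\sum_(0 <= j < m) a j * (P j).[x] +
                              \sum_(m <= j < n) l j * (P j).[x]))
    @[n --> \oo] --> 0%E.

(* The integral of f from a to b, for a and b in either order. *)
Definition oint (a b : R) (f : R -> R) : R :=
  if a <= b then \int[mu]_(x in `[a, b]) f x
  else - \int[mu]_(x in `[b, a]) f x.

End WeightedL2.

Section SimplifyingAssumptions.
Context {R : realType}.
Local Notation mu := (@lebesgue_measure R).
Variables (I : interval R) (w : R -> R) (Abar : R -> R -> R) (B C : R -> R).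

Definition cond_B (xi : nat) : Prop :=
  forall k : nat, (1 <= k <= xi)%N ->
    \int[mu]_(t in [set` I]) (B t * w t * C t ^+ k.-1) = k%:R^-1.

Definition cond_CN (eta : nat) : Prop :=
  forall t, t \in I -> forall k : nat, (1 <= k <= eta.-1)%N ->
    \int[mu]_(s in [set` I]) (Abar t s * w s * C s ^+ k.-1) =
    C t ^+ k.+1 / (k%:R * k.+1%:R).

Definition cond_DN (zeta : nat) : Prop :=
  forall s, s \in I -> forall k : nat, (1 <= k <= zeta.-1)%N ->
    \int[mu]_(t in [set` I]) (B t * w t * C t ^+ k.-1 * Abar t s) =
    B s * C s ^+ k.+1 / (k%:R * k.+1%:R) - B s * C s / k%:R + B s / k.+1%:R.

Variable P : nat -> {poly R}.

Definition B_form (xi : nat) (lambda : nat -> R) : Prop :=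
  L2w_expansion I w P xi B (fun j => oint 0 1 (horner (P j))) lambda.

Definition CN_form (eta : nat) (phi : nat -> R -> R) : Prop :=
  forall t, t \in I ->
  L2w_expansion I w P eta.-1 (fun s => Abar t s)
    (fun j => oint 0 t (fun alpha => oint 0 alpha (horner (P j))))
    (fun j => phi j t).

Definition DN_form (zeta : nat) (psi : nat -> R -> R) : Prop :=
  forall s, s \in I ->
  L2w_expansion I w P zeta.-1 (fun t => B t * Abar t s)
    (fun j => B s * (oint 0 s (fun alpha => oint 1 alpha (horner (P j))) +
                     oint 0 1 (fun x => x * (P j).[x])))
    (fun j => psi j s).

End SimplifyingAssumptions.

(* Main.v *)
Require Import Defs.
From HB Require Import structures.
From mathcomp Require Import all_boot all_order all_algebra.
From mathcomp Require Import all_classical all_reals all_analysis.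
From mathcomp Require Import measurable_realfun ring lra.

Set Implicit Arguments.
Unset Strict Implicit.
Unset Printing Implicit Defensive.

Import Order.TTheory GRing.Theory Num.Theory.
Import numFieldNormedType.Exports.

Local Open Scope classical_set_scope.
Local Open Scope ring_scope.

(** Each simplifying condition says that one function u of L^2_w(I) (B, or
    a section of Abar or of B * Abar) has prescribed moments
      <u, x^k>_w = L(x^k)   for k < m,
    where L is a linear functional on polynomials: the integral over [0, 1]
    for (a), the iterated integral from 0 for (b), and for (c) the factor
    B(s) times the sum of an iterated integral and a first moment.  That the
    right-hand sides of the conditions are the values L(x^k) is a computation
    with polynomial primitives ([B_functionalXn], [CN_functionalXn],
    [DN_functionalXn]).

    Both sides of such a condition are linear, and x^0, ..., x^(m-1) spans the
    same space as P_0, ..., P_(m-1), because deg P_j = j.  The condition is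
    thus equivalent to <u, P_j>_w = L(P_j) for j < m
    ([eq_scalar_monomials]): it prescribes the first m Fourier coefficients
    of u and leaves the others free.

    It remains to see that prescribed Fourier coefficients and orthogonal
    expansions are the same thing.  If a series in the P_j converges to u, its
    coefficients are the Fourier coefficients of u, since one coefficient is
    continuous in u by Bessel's inequality ([L2w_expansion_coef]).
    Conversely the Fourier series of u converges to u, because its partial
    sums are best approximations and the span of the P_j is dense
    ([L2w_expansion_fourier]).  The free coefficients can therefore be taken
    to be the Fourier coefficients, so that the square-integrable variants of
    (b) and (c) ask for exactly what their extra hypothesis grants. *)

(** * Linear functionals on polynomials *)

Section DegreeGradedFamilies.
Context {R : fieldType}.
Implicit Types (f g : {poly R} -> R) (p : {poly R}) (Q : nat -> {poly R}).

(** Such a Q is a triangular basis: subtracting the right multiple of Q m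
    lowers the degree of a polynomial of degree m. *)
Lemma eq_scalar_graded Q f g (m : nat) :
  (forall n, size (Q n) = n.+1) -> scalar f -> scalar g ->
  (forall j, (j < m)%N -> f (Q j) = g (Q j)) <->
  (forall p, (size p <= m)%N -> f p = g p).
Proof.
move=> szQ linf ling; split=> [fg p|fg j jm]; last by rewrite fg// szQ.
elim: m fg p => [_ p|m IH fg p szp].
  rewrite leqn0 size_poly_eq0 => /eqP ->.
  have zero (h : {poly R} -> R) : scalar h -> h 0 = 0.
    by move=> linh; have := linh (-1) 0 0; rewrite scaler0 addr0 mulN1r addNr.
  by rewrite !zero.
set c := p`_m / lead_coef (Q m).
have lead_neq0 : lead_coef (Q m) != 0.
  by rewrite lead_coef_eq0 -size_poly_gt0 szQ.
rewrite -(subrK (c *: Q m) p) addrC linf ling fg//; congr (_ + _).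
apply: IH => [j jm|]; first by apply: fg; exact: ltnW.
apply/leq_sizeP => i; rewrite leq_eqVlt => /predU1P[<-|mi].
  rewrite coefB coefZ; have -> : (Q m)`_m = lead_coef (Q m).
    by rewrite lead_coefE szQ.
  by rewrite divfK// subrr.
by rewrite coefB coefZ !nth_default ?mulr0 ?subr0 ?szQ// (leq_trans szp).
Qed.

(** The change of basis that turns moment conditions into conditions on
    Fourier coefficients. *)
Lemma eq_scalar_monomials Q f g (m : nat) :
  (forall n, size (Q n) = n.+1) -> scalar f -> scalar g ->
  (forall k, (k < m)%N -> f 'X^k = g 'X^k) <->
  (forall j, (j < m)%N -> f (Q j) = g (Q j)).
Proof.
move=> szQ linf ling; rewrite (eq_scalar_graded _ szQ)//.
by apply: eq_scalar_graded => // n; rewrite size_polyXn.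
Qed.

End DegreeGradedFamilies.

(** * Integrals of polynomials *)

Section PolynomialPrimitive.
Context {R : realType}.
Implicit Types p q : {poly R}.

(** At [i = 0] the coefficient is a division by zero, hence 0: this is the
    primitive that vanishes at the origin. *)
Definition primitive p : {poly R} := \poly_(i < (size p).+1) (p`_i.-1 / i%:R).

Lemma coef_primitive p i : (primitive p)`_i = p`_i.-1 / i%:R.
Proof.
rewrite coef_poly; case: ltnP => // szi.
by case: i szi => // i; rewrite ltnS => szi; rewrite nth_default ?mul0r.
Qed.

Lemma deriv_primitive p : (primitive p)^`() = p.
Proof.
by apply/polyP => i; rewrite coef_deriv coef_primitive -[LHS]mulr_natr divfK.
Qed.

Lemma primitive_linear a p q :
  primitive (a *: p + q) = a *: primitive p + primitive q.
Proof.
apply/polyP => i.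
by rewrite coefD coefZ !coef_primitive coefD coefZ mulrDl mulrA.
Qed.

Lemma horner0_primitive p : (primitive p).[0] = 0.
Proof. by rewrite horner_coef0 coef_primitive invr0 mulr0. Qed.

Lemma primitiveXn k : primitive 'X^k = k.+1%:R^-1 *: 'X^(k.+1).
Proof.
apply/polyP => -[|i]; rewrite coef_primitive coefZ !coefXn/=.
  by rewrite invr0 !mulr0.
by rewrite eqSS; case: eqP => [->|_]; rewrite ?mul0r ?mulr0// mul1r mulr1.
Qed.

Lemma primitiveZ a p : primitive (a *: p) = a *: primitive p.
Proof.
have primitive0 : primitive 0 = 0.
  by apply/polyP => i; rewrite coef_primitive !coef0 mul0r.
by rewrite -[a *: p]addr0 primitive_linear primitive0 addr0.
Qed.

Lemma primitiveC c : primitive c%:P = c *: 'X.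
Proof.
by rewrite -[c%:P]alg_polyC primitiveZ (primitiveXn 0) invr1 scale1r.
Qed.

Lemma primitiveB p q : primitive (p - q) = primitive p - primitive q.
Proof. by rewrite addrC -scaleN1r primitive_linear scaleN1r addrC. Qed.

Lemma oint_horner a b p :
  oint a b (horner p) = (primitive p).[b] - (primitive p).[a].
Proof.
have ftc c d : c < d ->
    \int[lebesgue_measure]_(x in `[c, d]) p.[x] =
    (primitive p).[d] - (primitive p).[c].
  move=> cd; rewrite /Rintegral (@continuous_FTC2 _ _ (horner (primitive p)))//.
  - by apply: continuous_subspaceT; exact: continuous_horner.
  - split.
    + by move=> x _; exact: derivable_horner.
    + by apply: cvg_at_right_filter; exact: continuous_horner.
    + by apply: cvg_at_left_filter; exact: continuous_horner.
  - by move=> x _; rewrite -derivE deriv_primitive.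
rewrite /oint; case: ltgtP => [ab|ba|->]; first exact: ftc.
  by rewrite ftc// opprB.
by rewrite set_itv1 Rintegral_set1 subrr.
Qed.

End PolynomialPrimitive.

(** * The weighted inner product *)

Section WeightedInnerProduct.
Context {R : realType}.
Variables (I : interval R) (w : R -> R).
Hypothesis w_weight : is_weight I w.
Local Notation mu := (@lebesgue_measure R).
Implicit Types (u v z : R -> R) (p q : {poly R}).

Let measurable_I : measurable ([set` I] : set (measurableTypeR R)).
Proof. exact: measurable_itv. Qed.

Lemma measurable_weight : measurable_fun [set` I] w.
Proof.
have /integrableP[/measurable_EFinP mw _] := weight_moment w_weight 0.
by apply: eq_measurable_fun mw => x _; rewrite mul1r.
Qed.

Let measurable_ip_integrand u v :
  measurable_fun [set` I] u -> measurable_fun [set` I] v ->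
  measurable_fun [set` I] (fun x => (u x * v x * w x)%:E).
Proof.
move=> mu_u mu_v; apply/measurable_EFinP; apply: measurable_funM.
  exact: measurable_funM.
exact: measurable_weight.
Qed.

Lemma L2wP u : L2w I w u <-> measurable_fun [set` I] u /\
  mu.-integrable [set` I] (fun x => (u x * u x * w x)%:E).
Proof.
have sqE : sqnorm I w u = (\int[mu]_(x in [set` I]) `|(u x * u x * w x)%:E|)%E.
  apply: eq_integral => x; rewrite inE => xI.
  rewrite gee0_abs; first by rewrite real_normK ?num_real// expr2.
  by rewrite lee_fin mulr_ge0 ?(weight_ge0 w_weight)// -expr2 sqr_ge0.
rewrite /L2w sqE; split=> -[mu_u]; last by move=> /integrableP[].
by split=> //; apply/integrableP; split=> //; exact: measurable_ip_integrand.
Qed.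

Lemma sqnormE u : L2w I w u -> sqnorm I w u = (ip I w u u)%:E.
Proof.
move=> /L2wP[_ iu]; rewrite /ip /Rintegral fineK; last first.
  exact: integrable_fin_num.
by apply: eq_integral => x _; rewrite real_normK ?num_real// expr2.
Qed.

(** The integrand is dominated by u^2 w + v^2 w. *)
Lemma ip_integrable u v : L2w I w u -> L2w I w v ->
  mu.-integrable [set` I] (fun x => (u x * v x * w x)%:E).
Proof.
move=> /L2wP[mu_u iu] /L2wP[mu_v iv].
apply: le_integrable (integrableD measurable_I iu iv) => //.
  exact: measurable_ip_integrand.
move=> x xI; have w0 := weight_ge0 w_weight xI.
rewrite -EFinD !abse_EFin lee_fin -mulrDl !normrM ler_wpM2r//.
rewrite -normrM -!expr2 (ger0_norm (addr_ge0 (sqr_ge0 _) (sqr_ge0 _))).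
by rewrite ler_norml; apply/andP; split; nra.
Qed.

Lemma ip_sym u v : ip I w u v = ip I w v u.
Proof. by apply: eq_Rintegral => x _; rewrite (mulrC (u x)). Qed.

Lemma ip_ge0 u : 0 <= ip I w u u.
Proof.
apply: Rintegral_ge0 => x xI.
by rewrite mulr_ge0 ?(weight_ge0 w_weight)// -expr2 sqr_ge0.
Qed.

Lemma L2w_comb (c : R) u v : L2w I w u -> L2w I w v ->
  L2w I w (fun x => u x + c * v x).
Proof.
move=> Lu Lv; have iuv := ip_integrable Lu Lv.
have [/L2wP[mu_u iu] /L2wP[mu_v iv]] := (Lu, Lv); apply/L2wP; split.
  by apply: measurable_funD => //; exact: measurable_funM.
have := integrableD measurable_I iu (integrableD measurable_I
  (integrableZl measurable_I (2 * c) iuv)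
  (integrableZl measurable_I (c ^+ 2) iv)).
apply: eq_integrable => // x _ /=.
by rewrite -!EFinM -!EFinD; congr EFin; ring.
Qed.

Lemma ip_combl (c : R) u v z : L2w I w u -> L2w I w v -> L2w I w z ->
  ip I w (fun x => u x + c * v x) z = ip I w u z + c * ip I w v z.
Proof.
move=> Lu Lv Lz; have iuz := ip_integrable Lu Lz.
have ivz := ip_integrable Lv Lz.
rewrite /ip -RintegralZl// -RintegralD//; last first.
  have := integrableZl measurable_I c ivz.
  by apply: eq_integrable => // x _ /=; rewrite -EFinM.
by apply: eq_Rintegral => x _; ring.
Qed.

Lemma ip_combr (c : R) u v z : L2w I w u -> L2w I w v -> L2w I w z ->
  ip I w z (fun x => u x + c * v x) = ip I w z u + c * ip I w z v.
Proof. by move=> Lu Lv Lz; rewrite ip_sym ip_combl// !(ip_sym z). Qed.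

(** The square of a polynomial is again a polynomial, so its weighted integral
    is a finite combination of moments of w. *)
Lemma L2w_horner p : L2w I w (horner p).
Proof.
apply/L2wP; split.
  apply: measurable_funTS; apply: continuous_measurable_fun.
  exact: continuous_horner.
have : mu.-integrable [set` I] (fun x =>
    (\sum_(i < size (p * p)%R) ((p * p)%R`_i)%:E * (x ^+ i * w x)%:E)%E).
  apply: integrable_sum => // i _; apply: integrableZl => //.
  exact: weight_moment.
apply: eq_integrable => // x _.
rewrite -hornerM horner_coef mulr_suml -sumEFin; apply: eq_bigr => i _.
by rewrite -EFinM mulrA.
Qed.

Lemma scalar_ip_horner u : L2w I w u ->
  scalar (fun p => ip I w u (horner p)).
Proof.
move=> Lu a p q /=; rewrite addrC -ip_combr//; try exact: L2w_horner.
by apply: eq_Rintegral => x _; rewrite hornerD hornerZ addrC.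
Qed.

(** * Orthogonal expansions *)

Section OrthonormalExpansion.
Variable P : nat -> {poly R}.
Hypothesis P_orthonormal : orthonormal_polys I w P.

Definition combination (b : nat -> R) n : {poly R} :=
  \sum_(0 <= j < n) b j *: P j.

Let horner_combination b n x :
  (combination b n).[x] = \sum_(0 <= j < n) b j * (P j).[x].
Proof. by rewrite horner_sum; apply: eq_bigr => j _; rewrite hornerZ. Qed.

Let L2w_residual u p : L2w I w u -> L2w I w (fun x => u x - p.[x]).
Proof.
move=> Lu; have := L2w_comb (-1) Lu (L2w_horner p).
by under eq_fun do rewrite mulN1r.
Qed.

Let ip_combination v b n : L2w I w v ->
  ip I w v (horner (combination b n)) =
  \sum_(0 <= j < n) b j * ip I w v (horner (P j)).
Proof.
move=> Lv; have lin := scalar_ip_horner Lv.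
elim: n => [|n IH].
  rewrite /combination !big_geq// /ip.
  under eq_Rintegral do rewrite horner0 mulr0 mul0r.
  by rewrite /Rintegral integral0.
rewrite /combination !big_nat_recr//= addrC lin -/(combination b n) IH.
by rewrite addrC.
Qed.

Let ip_residual u b n j : L2w I w u -> (j < n)%N ->
  ip I w (fun x => u x - (combination b n).[x]) (horner (P j)) =
  ip I w u (horner (P j)) - b j.
Proof.
move=> Lu jn; have [_ onP] := P_orthonormal.
transitivity
  (ip I w (fun x => u x + (-1) * (combination b n).[x]) (horner (P j))).
  by congr ip; apply/funext => x; rewrite mulN1r.
rewrite ip_combl//; try exact: L2w_horner.
rewrite mulN1r (ip_sym (horner _)) ip_combination; last exact: L2w_horner.
congr (_ - _).
rewrite big_mkord (bigD1 (Ordinal jn))//= onP eqxx mulr1 big1 ?addr0// => i.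
by rewrite onP => /negPf; rewrite -val_eqE/= eq_sym => ->; rewrite mulr0.
Qed.

(** Bessel's inequality for a single P j: expand the nonnegative square
    norm of v - c P_j with c = <v, P_j>. *)
Lemma bessel1 v j : L2w I w v -> ip I w v (horner (P j)) ^+ 2 <= ip I w v v.
Proof.
move=> Lv; set c := ip I w v _; have [_ onP] := P_orthonormal.
have LP := L2w_horner (P j); have Lr := L2w_comb (- c) Lv LP.
have := ip_ge0 (fun x => v x + (- c) * (P j).[x]).
rewrite ip_combl// !ip_combr// onP eqxx (ip_sym _ v) -/c.
by rewrite mulr1n; lra.
Qed.

Definition sqdist u p : R :=
  ip I w (fun x => u x - p.[x]) (fun x => u x - p.[x]).

(** The residual v of the Fourier sum is orthogonal to P_0, ..., P_(n-1), so
    replacing c by b only adds the square norm of the polynomial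
    r = sum (c_j - b_j) P_j. *)
Lemma best_approximation u b c n : L2w I w u ->
  (forall j, (j < n)%N -> c j = ip I w u (horner (P j))) ->
  sqdist u (combination c n) <= sqdist u (combination b n).
Proof.
move=> Lu cE; rewrite /sqdist; set v := fun x => u x - (combination c n).[x].
have Lv : L2w I w v by exact: L2w_residual.
pose r := combination (fun j => c j - b j) n.
have Lr : L2w I w (horner r) by exact: L2w_horner.
have vr : ip I w v (horner r) = 0.
  rewrite ip_combination// big1_seq// => j; rewrite mem_index_iota => /= jn.
  by rewrite ip_residual// cE// subrr mulr0.
have rE x : r.[x] = (combination c n).[x] - (combination b n).[x].
  rewrite !horner_combination -sumrN -big_split; apply: eq_bigr => j _ /=.
  by rewrite mulrBl.
have -> : (fun x => u x - (combination b n).[x]) =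
          (fun x => v x + 1 * r.[x]).
  by apply/funext => x; rewrite mul1r rE addrA subrK.
rewrite ip_combl ?ip_combr ?(ip_sym (horner r) v) ?vr//; last exact: L2w_comb.
by rewrite !mul1r addr0 add0r lerDl ip_ge0.
Qed.

(** Makes a partial sum of an expansion a single [combination], to which the
    two results above apply. *)
Let glue m (a l : nat -> R) j := if (j < m)%N then a j else l j.

Let expansion_partial_sum m a l n x : (m <= n)%N ->
  \sum_(0 <= j < m) a j * (P j).[x] + \sum_(m <= j < n) l j * (P j).[x] =
  (combination (glue m a l) n).[x].
Proof.
move=> mn; rewrite horner_combination [RHS](big_cat_nat _ mn)//=; congr (_ + _).
  by apply: eq_big_nat => j /= jm; rewrite /glue jm.
by apply: eq_big_nat => j /andP[mj _]; rewrite /glue ltnNge mj.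
Qed.

(** By Bessel's inequality the residual of a partial sum bounds
    (<u, P_j> - a_j)^2, whatever the free coefficients are. *)
Lemma L2w_expansion_coef m u a l : L2w I w u -> L2w_expansion I w P m u a l ->
  forall j, (j < m)%N -> ip I w u (horner (P j)) = a j.
Proof.
move=> Lu ul j jm; apply/eqP; rewrite -subr_eq0 -sqrf_eq0 eq_le sqr_ge0 andbT.
rewrite -lee_fin; apply: cvge_ge ul; near=> n.
have mn : (m <= n)%N by near: n; exact: nbhs_infty_ge.
under eq_fun do rewrite expansion_partial_sum//.
have Lr := L2w_residual (combination (glue m a l) n) Lu.
rewrite sqnormE// lee_fin (le_trans _ (bessel1 j Lr))//.
by rewrite ip_residual ?(leq_trans jm)// /glue jm.
Unshelve. all: by end_near. Qed.

(** Density provides one combination of P_0, ..., P_(k-1) close to u; padded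
    with zeros it competes with every later Fourier sum, which is at least as
    close. *)
Lemma L2w_expansion_fourier m u a : complete_set I w P -> L2w I w u ->
  (forall j, (j < m)%N -> ip I w u (horner (P j)) = a j) ->
  L2w_expansion I w P m u a (fun j => ip I w u (horner (P j))).
Proof.
move=> P_complete Lu ua; set c := fun j => _.
have gc n : combination (glue m a c) n = combination c n.
  by apply: eq_bigr => j _; rewrite /glue; case: ifP => // /ua <-.
have NE p : sqnorm I w (fun x => u x - p.[x]) = (sqdist u p)%:E.
  by rewrite sqnormE//; exact: L2w_residual.
rewrite /L2w_expansion.
apply: (@cvg_trans _ ((sqdist u (combination c n))%:E @[n --> \oo])).
  apply: near_eq_cvg; near=> n.
  have mn : (m <= n)%N by near: n; exact: nbhs_infty_ge.
  by rewrite -NE -gc; under [in RHS]eq_fun do rewrite expansion_partial_sum//.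
apply: cvg_EFin; first by near=> n.
apply/cvgrPdist_lt => e e0; have [k [b]] := P_complete u Lu e e0.
under eq_fun do rewrite -horner_combination.
rewrite NE lte_fin => Ne; near=> n.
have kn : (k <= n)%N by near: n; exact: nbhs_infty_ge.
rewrite sub0r normrN /= ger0_norm ?ip_ge0//; apply: le_lt_trans Ne.
have -> : combination b k = combination (glue k b (fun=> 0)) n.
  rewrite /combination [RHS](big_cat_nat _ kn)//=.
  rewrite [X in _ + X]big_nat [X in _ + X]big1 ?addr0.
    by apply: eq_big_nat => j /= jk; rewrite /glue jk.
  by move=> j /andP[kj _]; rewrite /glue ltnNge kj scale0r.
exact: best_approximation.
Unshelve. all: by end_near. Qed.

(** The common core of the three equivalences.  In the forward direction the
    free coefficients are named, so that their integrability in a parameter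
    can be asserted. *)
Lemma L2w_expansion_moments m u (L : {poly R} -> R) :
  complete_set I w P -> L2w I w u -> scalar L ->
  let moments := forall k, (1 <= k <= m)%N ->
    ip I w u (horner 'X^(k.-1)) = L 'X^(k.-1) in
  let expands := L2w_expansion I w P m u (fun j => L (P j)) in
  (moments -> expands (fun j => ip I w u (horner (P j)))) /\
  (forall l, expands l -> moments).
Proof.
move=> P_complete Lu linL moments expands; have [szP _] := P_orthonormal.
have momentsE : moments <->
    forall j, (j < m)%N -> ip I w u (horner (P j)) = L (P j).
  rewrite -(eq_scalar_monomials _ szP (scalar_ip_horner Lu) linL).
  by split=> [h k km|h [|k]// km]; [exact: (h k.+1)|exact: h].
split=> [/momentsE h|l h]; first exact: L2w_expansion_fourier.
by apply/momentsE; exact: L2w_expansion_coef h.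
Qed.

End OrthonormalExpansion.
End WeightedInnerProduct.

(** * The functionals of the three conditions *)

Section IteratedIntegrals.
Context {R : realType}.
Implicit Types p : {poly R}.

Lemma oint01_horner p : oint 0 1 (horner p) = (primitive p).[1].
Proof. by rewrite oint_horner horner0_primitive subr0. Qed.

Lemma oint_oint0_horner t p :
  oint 0 t (fun alpha => oint 0 alpha (horner p)) =
  (primitive (primitive p)).[t].
Proof.
have -> : (fun alpha => oint 0 alpha (horner p)) = horner (primitive p).
  by apply/funext => x; rewrite oint_horner horner0_primitive subr0.
by rewrite oint_horner horner0_primitive subr0.
Qed.

Lemma oint_oint1_horner s p :
  oint 0 s (fun alpha => oint 1 alpha (horner p)) =
  (primitive (primitive p)).[s] - (primitive p).[1] * s.
Proof.
have -> : (fun alpha => oint 1 alpha (horner p)) =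
    horner (primitive p - (primitive p).[1]%:P).
  by apply/funext => x; rewrite oint_horner hornerD hornerN hornerC.
rewrite oint_horner horner0_primitive subr0 primitiveB primitiveC.
by rewrite hornerD hornerN hornerZ hornerX.
Qed.

Lemma oint01_id_horner p :
  oint 0 1 (fun x => x * p.[x]) = (primitive ('X * p)).[1].
Proof.
have -> : (fun x => x * p.[x]) = horner ('X * p).
  by apply/funext => x; rewrite hornerM hornerX.
by rewrite oint01_horner.
Qed.

Lemma scalar_B_functional : scalar (fun p => oint 0 1 (horner p)).
Proof.
by move=> a p q /=; rewrite !oint01_horner primitive_linear hornerD hornerZ.
Qed.

Lemma scalar_CN_functional t :
  scalar (fun p => oint 0 t (fun alpha => oint 0 alpha (horner p))).
Proof.
move=> a p q /=.
by rewrite !oint_oint0_horner !primitive_linear hornerD hornerZ.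
Qed.

Lemma scalar_DN_functional b s :
  scalar (fun p => b * (oint 0 s (fun alpha => oint 1 alpha (horner p)) +
                        oint 0 1 (fun x => x * p.[x]))).
Proof.
move=> a p q /=; rewrite !oint_oint1_horner !oint01_id_horner.
rewrite (mulrDr 'X) -(scalerAr a 'X) !primitive_linear !hornerD !hornerZ.
by ring.
Qed.

Lemma B_functionalXn k : oint 0 1 (horner 'X^k) = k.+1%:R^-1 :> R.
Proof. by rewrite oint01_horner primitiveXn hornerZ hornerXn expr1n mulr1. Qed.

Lemma CN_functionalXn (t : R) k :
  oint 0 t (fun alpha => oint 0 alpha (horner 'X^k)) =
  t ^+ k.+2 / (k.+1%:R * k.+2%:R).
Proof.
rewrite oint_oint0_horner primitiveXn primitiveZ primitiveXn.
by rewrite !hornerZ hornerXn invfM mulrA mulrC.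
Qed.

Lemma DN_functionalXn (b s : R) k :
  b * (oint 0 s (fun alpha => oint 1 alpha (horner 'X^k)) +
       oint 0 1 (fun x => x * ('X^k).[x])) =
  b * s ^+ k.+2 / (k.+1%:R * k.+2%:R) - b * s / k.+1%:R + b / k.+2%:R.
Proof.
rewrite oint_oint1_horner oint01_id_horner -exprS.
rewrite !primitiveXn primitiveZ primitiveXn !hornerZ !hornerXn !expr1n !mulr1 invfM.
by set c := k.+1%:R^-1; set d := k.+2%:R^-1; ring.
Qed.

End IteratedIntegrals.

(** * The theorem *)

(* In (b) and (c), sectionwise square-integrability of the coefficients does
   not make the Fourier coefficients phi_j, psi_j square-integrable in their
   own variable.  Each of (b), (c) is therefore stated twice: with arbitrary
   real functions phi_j, psi_j, and with phi_j, psi_j in L^2_w(I) when the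
   corresponding Fourier coefficient functions are in L^2_w(I). *)
Theorem theorem3p4 (R : realType) (I : interval R) (w : R -> R)
    (P : nat -> {poly R}) (Abar : R -> R -> R) (B C : R -> R)
    (xi eta zeta : nat)
    (w_weight : is_weight I w)
    (P_orthonormal : orthonormal_polys I w P)
    (P_complete : complete_set I w P)
    (C_id : forall t, t \in I -> C t = t)
    (B_L2 : L2w I w B)
    (Abar_L2 : forall t, t \in I -> L2w I w (fun s => Abar t s))
    (BAbar_L2 : forall s, s \in I -> L2w I w (fun t => B t * Abar t s))
    (xi_gt0 : (0 < xi)%N) (eta_gt0 : (0 < eta)%N) (zeta_gt0 : (0 < zeta)%N) :
  (* (a) *)
  (cond_B I w B C xi <->
     exists lambda : nat -> R, B_form I w B P xi lambda) /\
  (* (b) *)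
  ((cond_CN I w Abar C eta <->
      exists phi : nat -> R -> R, CN_form I w Abar P eta phi) /\
   ((forall j, (eta.-1 <= j)%N ->
       L2w I w (fun t => ip I w (fun s => Abar t s) (horner (P j)))) ->
    (cond_CN I w Abar C eta <->
      exists phi : nat -> R -> R,
        (forall j, (eta.-1 <= j)%N -> L2w I w (phi j)) /\
        CN_form I w Abar P eta phi))) /\
  (* (c) *)
  ((cond_DN I w Abar B C zeta <->
      exists psi : nat -> R -> R, DN_form I w Abar B P zeta psi) /\
   ((forall j, (zeta.-1 <= j)%N ->
       L2w I w (fun s => ip I w (fun t => B t * Abar t s) (horner (P j)))) ->
    (cond_DN I w Abar B C zeta <->
      exists psi : nat -> R -> R,
        (forall j, (zeta.-1 <= j)%N -> L2w I w (psi j)) /\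
        DN_form I w Abar B P zeta psi))).
Proof.
have exB := L2w_expansion_moments w_weight P_orthonormal xi P_complete B_L2
  (@scalar_B_functional R).
have exCN t (tI : t \in I) := L2w_expansion_moments w_weight
  P_orthonormal eta.-1 P_complete (Abar_L2 t tI) (@scalar_CN_functional R t).
have exDN s (sI : s \in I) := L2w_expansion_moments w_weight
  P_orthonormal zeta.-1 P_complete (BAbar_L2 s sI) (@scalar_DN_functional R (B s) s).
(* On I the node function C is the identity, so each condition is a moment
   condition for the inner product. *)
have BE : cond_B I w B C xi <-> forall k, (1 <= k <= xi)%N ->
    ip I w B (horner 'X^(k.-1)) = oint 0 1 (horner 'X^(k.-1)).
  have BpowE k : ip I w B (horner 'X^k) =
      \int[lebesgue_measure]_(t in [set` I]) (B t * w t * C t ^+ k).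
    apply: eq_Rintegral => t; rewrite inE/= => tI.
    by rewrite hornerXn C_id//; ring.
  by split=> h [|k]// /h; rewrite B_functionalXn BpowE.
have CNE : cond_CN I w Abar C eta <-> forall t, t \in I ->
    forall k, (1 <= k <= eta.-1)%N ->
    ip I w (fun s => Abar t s) (horner 'X^(k.-1)) =
    oint 0 t (fun alpha => oint 0 alpha (horner 'X^(k.-1))).
  have CNpowE t k : ip I w (fun s => Abar t s) (horner 'X^k) =
      \int[lebesgue_measure]_(s in [set` I]) (Abar t s * w s * C s ^+ k).
    apply: eq_Rintegral => s; rewrite inE/= => sI.
    by rewrite hornerXn C_id//; ring.
  by split=> h t tI [|k]// /(h t tI); rewrite CN_functionalXn C_id// CNpowE.
have DNE : cond_DN I w Abar B C zeta <-> forall s, s \in I ->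
    forall k, (1 <= k <= zeta.-1)%N ->
    ip I w (fun t => B t * Abar t s) (horner 'X^(k.-1)) =
    B s * (oint 0 s (fun alpha => oint 1 alpha (horner 'X^(k.-1))) +
           oint 0 1 (fun x => x * ('X^(k.-1)).[x])).
  have DNpowE s k : ip I w (fun t => B t * Abar t s) (horner 'X^k) =
      \int[lebesgue_measure]_(t in [set` I]) (B t * w t * C t ^+ k * Abar t s).
    apply: eq_Rintegral => t; rewrite inE/= => tI.
    by rewrite hornerXn C_id//; ring.
  by split=> h s sI [|k]// /(h s sI); rewrite DN_functionalXn C_id// DNpowE.
have CNto : cond_CN I w Abar C eta -> CN_form I w Abar P eta
    (fun j t => ip I w (fun s => Abar t s) (horner (P j))).
  by move=> /CNE h t tI; apply: (exCN t tI).1; exact: h.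
have CNof phi : CN_form I w Abar P eta phi -> cond_CN I w Abar C eta.
  by move=> h; apply/CNE => t tI; apply: (exCN t tI).2 (h t tI).
have DNto : cond_DN I w Abar B C zeta -> DN_form I w Abar B P zeta
    (fun j s => ip I w (fun t => B t * Abar t s) (horner (P j))).
  by move=> /DNE h s sI; apply: (exDN s sI).1; exact: h.
have DNof psi : DN_form I w Abar B P zeta psi -> cond_DN I w Abar B C zeta.
  by move=> h; apply/DNE => s sI; apply: (exDN s sI).2 (h s sI).
split; [|split; split].
- split=> [/BE h|[lambda h]]; first by eexists; exact: exB.1 h.
  by apply/BE; exact: exB.2 h.
- by split=> [/CNto h|[phi /CNof//]]; eexists; exact: h.
- move=> phiL2; split=> [/CNto h|[phi [_ /CNof//]]].
  by eexists; split; last exact: h.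
- by split=> [/DNto h|[psi /DNof//]]; eexists; exact: h.
- move=> psiL2; split=> [/DNto h|[psi [_ /DNof//]]].
  by eexists; split; last exact: h.
Qed.
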